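(* If $X$ is a first-countable, Hausdorff, and strongly cellular-Lindelöf topological space, then $$|X|\leq\mathfrak c,$$ where $\mathfrak c=2^{\omega}$ is the cardinality of the continuum.
   Context: A space is Lindelöf if every open cover has a countable subcover. A family of nonempty open sets is cellular if its members are pairwise disjoint. A space $X$ is strongly cellular-Lindelöf if, for every cellular family $\mathcal U$ of open subsets of $X$, there is a closed Lindelöf subspace $L$ of $X$ that meets every member of $\mathcal U$ (i.e. $L\cap U\neq\varnothing$ for every $U\in\mathcal U$). *)

(* Defs.v *)
From mathcomp Require Import all_boot.
From mathcomp Require Import all_classical topology.

Set Implicit Arguments.
Unset Strict Implicit.
Unset Printing Implicit Defensive.

Local Open Scope classical_set_scope.

Definition first_countable (T : topologicalType) : Prop :=
  forall x : T, exists2 B : set (set T), countable B &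
    B `<=` open_nbhs x /\
    (forall U, nbhs x U -> exists2 V, B V & V `<=` U).

Definition lindelof (T : topologicalType) : Prop :=
  forall U : set (set T), U `<=` open -> cover U id = [set: T] ->
    exists V : set (set T),
      [/\ V `<=` U, countable V & cover V id = [set: T]].

Definition cellular (T : topologicalType) (U : set (set T)) : Prop :=
  [/\ U `<=` open, (forall A, U A -> A !=set0) & trivIset U id].

(* [set_type L] is the subset [L] as a type; its canonical topology is the
   usual subspace topology, initial for the inclusion into [T]. The library's
   [subspace L] would be wrong here: it is a topology on the whole of [T], in
   which the points outside [L] are isolated. *)
Definition strongly_cellular_lindelof (T : topologicalType) : Prop :=
  forall U : set (set T), cellular U ->
    exists L : set T,
      [/\ closed L, lindelof (set_type L) & forall A, U A -> L `&` A !=set0].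

(* Main.v *)
Require Import Defs.
From mathcomp Require Import all_boot.
From mathcomp Require Import all_classical topology.
From mathcomp Require Import wochoice.

(** Why the bound holds.  Fix at each point a decreasing countable base [B x].

    The hypothesis on cellular families, stated for families of sets, controls
    families of points: if the points [f i] have pairwise disjoint open
    neighbourhoods [O i], then they all lie in one closed Lindelof set
    ([disjoint_expansion_lindelof]).  Indeed the annuli
    [B x k `\` closure (B x k.+1)] form a cellular family that converges to
    [x], so a closed set meeting all nonempty ones must contain [x] (an isolated
    [x] is forced by its own singleton); doing this inside every [O i] gives one
    cellular family for the whole set of points.

    The main step is a covering theorem for a closed set [H] whose points have
    assigned neighbourhoods [U x] and levels [n x] in [nat]: some countable
    [Z] included in [H] is such that [H] is covered by the countably many sets
    [closure (\bigcup_(z in Z, n z = m) U z)], one for each level [m]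
    ([countable_subfamily_levelwise_dense]).  If this failed, a recursion of
    length omega_1 would pick points [f a] of [H], each outside these closures
    for a countable set [Zs a] that contains all earlier points, and also
    enough centres to cover the closure of the earlier points of each level
    as soon as that closure is Lindelof.  Uncountably many [f a] share a level
    [m]; these have pairwise disjoint neighbourhoods, hence a Lindelof
    closure.  As closure points are limits of sequences, the increasing open
    sets [\bigcup_(z in Zs a) U z] cover this closure, so one of them does,
    contradicting the choice of a later [f a].

    Levels make this work in Hausdorff spaces that are not regular: for a
    point [p] outside [H], take for [n x] an index with [B x (n x)] disjoint
    from [B p (n x)].  The union of all neighbourhoods of level [m] then misses
    [B p m], so that its closure misses [p].

    Finally, let [H] be a set containing the limits of its convergent
    sequences and, for every sequence [s] in [H] and every assignment of levels
    [c], a point outside all the closures of [\bigcup_(i in c i = m) B (s i) m],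
    when there is one.  Such an [H] of cardinality at most the continuum
    is obtained by evaluating well-founded countably branching terms
    ([closing_off]).  It is closed; by the covering theorem a point outside [H]
    would yield such data whose chosen point is both in [H] and not covered.
    So [H] is the whole space. *)

Set Implicit Arguments.
Unset Strict Implicit.
Unset Printing Implicit Defensive.

Local Open Scope classical_set_scope.

(** * Countable sets and the first uncountable ordinal *)

Lemma countable_range (T : Type) (A : set T) :
  countable A -> A !=set0 -> exists s : nat -> T, range s = A.
Proof.
move=> /pfcard_geP[->[x []]|[s] _].
by exists s; apply/seteqP; split=> [_ [i _ <-]|x /(@surj _ _ _ _ s)//]; exact: funS.
Qed.

Lemma card_sets_nat_uncountable : ~ countable [set: set nat].
Proof.
move=> c; have [|s sT] := countable_range c; first by exists set0.
have : range s [set n | ~ s n n] by rewrite sT.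
move=> [n _ /(congr1 (@^~ n))/= e].
have nsn : ~ s n n by move=> h; move: (h); rewrite e.
by apply: (nsn); rewrite e.
Qed.

Lemma countable_preimage_inj (T U : Type) (f : T -> U) (A : set U) :
  injective f -> countable A -> countable (f @^-1` A).
Proof.
move=> fI /countable_injP[g gI]; apply/countable_injP; exists (g \o f).
by move=> x y /set_mem Ax /set_mem Ay /gI -/(_ _ _)/fI; apply; exact/mem_set.
Qed.

Lemma countable_image_set (T U : Type) (f : T -> U) (A : set T) :
  countable A -> countable (f @` A).
Proof. exact/sub_countable/card_image_le. Qed.

(** The points of a well-ordered uncountable set whose initial segment is
    countable are a copy of omega_1: were there only countably many of them,
    the least point that is not one of them would have a countable initial
    segment after all. *)
Lemma exists_omega1 : exists (W : Type) (lt : W -> W -> Prop),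
  [/\ well_founded lt,
      forall a b c, lt a b -> lt b c -> lt a c,
      forall a b, [\/ lt a b, a = b | lt b a],
      ~ countable [set: W] &
      forall a, countable [set b | lt b a]].
Proof.
have [R woR] := well_ordering_principle {classic set nat}.
set T := {classic set nat} in R woR.
have minR (A : set T) : A !=set0 -> exists2 m, A m & forall x, A x -> R m x.
  move=> [a Aa]; have [|m [[Am mmin] _]] := woR [pred x | `[<A x>]].
    by exists a; apply/asboolP.
  exists m; first by move/asboolP: Am.
  by move=> x Ax; apply: mmin; apply/asboolP.
have Rtot a b : R a b \/ R b a.
  have [|m [->|->] h] := minR [set a; b]; first by exists a; left.
    by left; apply: h; right.
  by right; apply: h; left.
have Ranti a b : R a b -> R b a -> a = b.
  move=> ab ba; have [|m [_ mu]] := woR [pred x | `[<[set a; b] x>]].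
    by exists a; apply/asboolP; left.
  have refl c : R c c by have [] := Rtot c c.
  have mE c : [set a; b] c -> R c a -> R c b -> m = c.
    move=> abc ca cb; apply: mu; split; first exact/asboolP.
    by move=> x /asboolP[]->.
  by rewrite -(mE a) ?(mE b)//; [right|left].
pose lt a b := ~ R b a.
have wflt : well_founded lt.
  move=> a; apply: contrapT => na.
  have [|m nm mmin] := minR [set x | ~ Acc lt x]; first by exists a.
  by apply: nm; constructor=> y ylt; apply: contrapT => /mmin.
have lt_trans a b c : lt a b -> lt b c -> lt a c.
  move=> ab bc ca.
  have [|m mabc h] := minR [set x | [\/ x = a, x = b | x = c]].
    by exists a; constructor 1.
  have [ha hb hc] : [/\ R m a, R m b & R m c].
    by split; apply: h; [constructor 1|constructor 2|constructor 3].
  case: mabc => e; rewrite e in ha hb hc => //.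
  by have e' := Ranti _ _ hc ca; rewrite e' in hb.
pose A : set T := [set b | countable [set c | lt c b]].
have cA : ~ countable A.
  move=> cA; apply: card_sets_nat_uncountable.
  have [AT|/existsNP[a nAa]] := pselect (forall x, A x).
    suff -> : [set: set nat] = A by [].
    by apply/seteqP; split=> x // _; exact: AT.
  exfalso; have [|m nm mmin] := minR (~` A); first by exists a.
  apply: nm; apply: sub_countable cA; apply: subset_card_le => c /= cm.
  by apply: contrapT => /mmin.
exists (set_type A), (fun a b => lt (val a) (val b)); split.
- move=> [a Aa]; elim/(well_founded_ind wflt): a Aa => a IH Aa.
  by constructor=> -[b Ab] /= ba; exact: IH.
- by move=> a b c; exact: lt_trans.
- move=> a b; have [ab|/contrapT ba] := pselect (lt (val a) (val b)).
    by constructor 1.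
  have [|/contrapT] := pselect (lt (val b) (val a)); first by constructor 3.
  by move=> ab; constructor 2; apply: val_inj; exact: Ranti.
- by rewrite (eq_countable (card_setT _)).
- move=> a; have Aa := set_valP a.
  exact: (@countable_preimage_inj _ _ (fun x : set_type A => val x) _ val_inj Aa).
Qed.

(** Dependent choice along a well-founded relation.  The history is passed as
    a total function, so the step [P] must not look at values that are not in
    the past, which is the first condition on [P]. *)
Lemma wf_recursive_choice (W T : Type) (lt : W -> W -> Prop)
    (P : W -> (W -> T) -> T -> Prop) :
  T -> well_founded lt ->
  (forall a f g v, (forall b, lt b a -> f b = g b) -> P a f v -> P a g v) ->
  (forall a f, (forall b, lt b a -> P b f (f b)) -> exists v, P a f v) ->
  exists f, forall a, P a f (f a).
Proof.
move=> d wf Pext Pex.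
have /choice[F FP] (af : W * (W -> T)) :
    exists v', (exists v, P af.1 af.2 v) -> P af.1 af.2 v'.
  by have [[v Pv]|nv] := pselect (exists v, P af.1 af.2 v); [exists v|exists d].
pose restr a (f : forall b, lt b a -> T) b :=
  if pselect (lt b a) is left h then f b h else d.
pose body a (f : forall b, lt b a -> T) := F (a, restr a f).
pose f := Fix wf (fun _ => T) body.
have fE a : f a = F (a, restr a (fun b _ => f b)).
  rewrite {1}/f Fix_eq// => x g h gh; rewrite /body; congr (F (_, _)).
  by apply: funext => b; rewrite /restr; case: pselect.
exists f; elim/(well_founded_ind wf) => a IH; rewrite fE.
have e b : lt b a -> f b = restr a (fun b _ => f b) b.
  by rewrite /restr; case: pselect.
have /= := FP (a, restr a (fun b _ => f b)).
move=> FPa; apply: (Pext _ _ _ _ _ (FPa _)) => [b /e->//|].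
have [v Pv] := Pex a f IH; exists v; exact: Pext Pv.
Qed.

(** * Closing off under operations of countable arity *)

(** Formal iterates of the operations indexed by [K] on sequences, with a single
    constant. *)
Inductive term (K : Type) : Type :=
  | Leaf
  | Node of K & (nat -> term K).

Fixpoint label (K : Type) (t : term K) (r : seq nat) : option K :=
  match t, r with
  | Leaf, _ => None
  | Node k _, [::] => Some k
  | Node _ s, n :: r' => label (s n) r'
  end.

Lemma label_inj (K : Type) : injective (@label K).
Proof.
elim=> [|k s IH] [|k' s'] // e; try by move/(congr1 (@^~ [::])): e.
have [->] : Some k = Some k' by exact: (congr1 (@^~ [::]) e).
congr Node; apply: funext => n; apply: IH; apply: funext => r.
exact: (congr1 (@^~ (n :: r)) e).
Qed.

(** A term is determined by the labels along its finite branches, and labels are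
    coded by [g] as sequences of numbers, so a term is a set of triples
    (branch, argument, value).  Every label contributes at least one triple to
    its branch, which tells it apart from the absence of a label. *)
Lemma card_term (K : Type) (g : K -> nat -> nat) :
  injective g -> ([set: term K] #<= [set: nat -> bool])%card.
Proof.
move=> gI; apply/pcard_injP.
pose bit (t : term K) (q : seq nat * nat * nat) :=
  if label t q.1.1 is Some k then g k q.1.2 == q.2 else false.
exists (fun t n => if unpickle n is Some q then bit t q else false).
move=> t u _ _ e; apply: label_inj; apply: funext => r.
have {}e i j : bit t (r, i, j) = bit u (r, i, j).
  by have := congr1 (@^~ (pickle (r, i, j))) e; rewrite /= pickleK.
rewrite /bit/= in e.
case: (label t r) e => [k|]; case: (label u r) => [k'|] // e.
- congr Some; apply: gI; apply: funext => i.
  by move: (e i (g k i)); rewrite eqxx => /esym/eqP.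
- by move: (e 0 (g k 0)); rewrite eqxx.
- by move: (e 0 (g k' 0)); rewrite eqxx.
Qed.

(** Terms take the place of an iteration of length omega_1: a sequence of values
    of terms is the sequence of arguments of one further term. *)
Lemma closing_off (K X : Type) (g : K -> nat -> nat)
    (F : K -> (nat -> X) -> X) (x0 : X) :
  injective g ->
  exists H : set X, [/\ H x0,
    forall k s, (forall i, H (s i)) -> H (F k s) &
    (H #<= [set: nat -> bool])%card].
Proof.
move=> gI.
pose eval := fix ev (t : term K) : X :=
  match t with Leaf => x0 | Node k s => F k (fun n => ev (s n)) end.
exists (range eval); split.
- by exists (Leaf K).
- move=> k s Hs; have /choice[t tE] i : exists t, eval t = s i.
    by have [t _ <-] := Hs i; exists t.
  by exists (Node k t) => //=; congr F; apply: funext.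
- exact: card_le_trans (card_image_le _ _) (card_term gI).
Qed.

(** * Decreasing bases in first-countable spaces *)

Definition decreasing_base (X : topologicalType) (B : X -> nat -> set X) :=
  forall x, [/\ forall k, open_nbhs x (B x k),
    forall j k, j <= k -> B x k `<=` B x j &
    forall U, nbhs x U -> exists k, B x k `<=` U].

Lemma exists_decreasing_base (X : topologicalType) :
  first_countable X -> exists B : X -> nat -> set X, decreasing_base B.
Proof.
move=> fcX; suff /choice[B BP] : forall x, exists Bx : nat -> set X,
   [/\ forall k, open_nbhs x (Bx k),
    forall j k, j <= k -> Bx k `<=` Bx j &
    forall U, nbhs x U -> exists k, Bx k `<=` U] by exists B.
move=> x; have [C cC [Copen Cnbhs]] := fcX x.
have [|e eC] := countable_range cC.
  by have [V CV _] := Cnbhs _ filterT; exists V.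
pose Bx := fix b k := if k is k'.+1 then b k' `&` e k'.+1 else e 0.
have eo k : open_nbhs x (e k) by apply: Copen; rewrite -eC; exists k.
exists Bx; split.
- by elim=> [|k IH]/=; [exact: eo|apply: open_nbhsI].
- move=> j k; elim: k => [|k IH]; first by rewrite leqn0 => /eqP->.
  by rewrite leq_eqVlt => /predU1P[->//|/IH h] y [/h].
- move=> U /Cnbhs[V]; rewrite -eC => -[k _ <-] eU; exists k.
  by apply: subset_trans eU; case: k => [|k] //= y [].
Qed.

Lemma hausdorff_separation (X : topologicalType) (x y : X) :
  hausdorff_space X -> x <> y ->
  exists U V : set X, [/\ open_nbhs x U, open_nbhs y V & U `&` V = set0].
Proof.
rewrite open_hausdorff => h /eqP/h[[U V] [/set_mem xU /set_mem yV] [oU oV /eqP e]].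
by exists U, V.
Qed.

Lemma closure_baseP (X : topologicalType) (B : X -> nat -> set X) (A : set X) x :
  decreasing_base B -> closure A x <-> forall k, A `&` B x k !=set0.
Proof.
move=> dB; have [Bo _ Bn] := dB x; split=> [cl k|h U /Bn[k BU]].
  by apply: cl; apply: open_nbhs_nbhs.
by have [y [Ay /BU]] := h k; exists y.
Qed.

Lemma hausdorff_base_separation (X : topologicalType) (B : X -> nat -> set X) x y :
  hausdorff_space X -> decreasing_base B -> x <> y ->
  exists k, B x k `&` B y k = set0.
Proof.
move=> hX dB /(hausdorff_separation hX)[U [V [xU yV UV]]].
have [[_ Bxd Bx] [_ Byd By]] := (dB x, dB y).
have [i Ui] := Bx U (open_nbhs_nbhs xU).
have [j Vj] := By V (open_nbhs_nbhs yV).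
exists (maxn i j); apply/seteqP; split=> // z [zx zy]; rewrite -UV; split.
  by apply: Ui; apply: Bxd zx; exact: leq_maxl.
by apply: Vj; apply: Byd zy; exact: leq_maxr.
Qed.

(** * Cellular families and closed Lindelof sets *)

(** At a point [x] that is not isolated, infinitely many of the open annuli
    [B x k `\` closure (B x k.+1)] are nonempty: if they were empty from [n] on,
    then [B x n] would lie in every [closure (B x j)], and these intersect in
    [x] alone by the Hausdorff property, so [x] would be isolated.  The annuli converge to [x], so
    [x] is a limit of any closed set meeting all the nonempty ones. *)
Lemma cellular_family_forcing_point (X : topologicalType) (B : X -> nat -> set X)
    (x : X) (O : set X) :
  hausdorff_space X -> decreasing_base B -> open_nbhs x O ->
  exists Q : set (set X), [/\ cellular Q, forall A, Q A -> A `<=` O &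
    forall L, closed L -> (forall A, Q A -> L `&` A !=set0) -> L x].
Proof.
move=> hX dB Ox; have [Bo Bd Bn] := dB x.
have [ox|nox] := pselect (open [set x]).
  exists [set [set x]]; split.
  - split=> [A ->//|A ->|A A' -> ->//]; by exists x.
  - by move=> A -> _ ->; exact: Ox.2.
  - by move=> L _ /(_ _ erefl)[y [Ly <-]].
have [m BmO] := Bn O (open_nbhs_nbhs Ox).
pose P k := B x k `\` closure (B x k.+1).
have oP k : open (P k).
  apply: openI; first by have [] := Bo k.
  exact/closed_openC/closed_closure.
have PP j k : j < k -> P j `&` P k = set0.
  move=> jk; apply/seteqP; split=> // y [[_ ny] [yk _]]; apply: ny.
  exact/subset_closure/(Bd _ _ jk).
have Pne n : exists2 k, n <= k & P k !=set0.
  apply: contrapT => hn; apply: nox.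
  suff -> : [set x] = B x n by have [] := Bo n.
  apply/seteqP; split=> [_ ->|y yn]; first by have [] := Bo n.
  apply: contrapT => yx.
  have [k kxy] := hausdorff_base_separation hX dB yx.
  (* an empty annulus says that B x j is included in closure (B x j.+1) *)
  have ycl j : n <= j -> B x n `<=` closure (B x j).
    elim: j => [|j IH]; first by rewrite leqn0 => /eqP <-; exact: subset_closure.
    rewrite leq_eqVlt => /predU1P[<-|nj]; first exact: subset_closure.
    apply: subset_trans (IH nj) _; rewrite [X in _ `<=` X](closure_id _).1.
      apply: closureS => z zj; apply: contrapT => nz.
      by apply: hn; exists j => //; exists z.
    exact: closed_closure.
  have /(closure_baseP _ _ dB)/(_ k)[z [zx zy]] := ycl _ (leq_maxl n k) _ yn.
  have : (B y k `&` B x k) z by split=> //; apply: Bd zx; exact: leq_maxr.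
  by rewrite kxy.
exists [set A | exists k, [/\ m <= k, P k !=set0 & A = P k]]; split.
- split=> [A [k [_ _ ->]]//|A [k [_ h ->]]//|A A' [j [_ _ ->]] [k [_ _ ->]] h].
  have [jk|kj|->//] := ltngtP j k.
    by move: h; rewrite PP// => /set0P/eqP.
  by move: h; rewrite setIC PP// => /set0P/eqP.
- by move=> A [k [mk _ ->]] y [/(Bd _ _ mk)/BmO].
- move=> L cL hL; rewrite (closure_id L).1//; apply/(closure_baseP _ _ dB) => k.
  have [j jk Pj] := Pne (maxn m k).
  have [|y [Ly [yj _]]] := hL (P j).
    by exists j; rewrite (leq_trans _ jk) ?leq_maxl.
  by exists y; split=> //; apply: Bd yj; rewrite (leq_trans _ jk) ?leq_maxr.
Qed.

(** A closed set meeting each member of a family that forces [f i] inside [O i],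
    for all [i] at once, contains every [f i]; the union of these families is
    cellular because the [O i] are disjoint. *)
Lemma disjoint_expansion_lindelof (X : topologicalType) (B : X -> nat -> set X)
    (I : Type) (S : set I) (f : I -> X) (O : I -> set X) :
  hausdorff_space X -> decreasing_base B -> strongly_cellular_lindelof X ->
  (forall i, S i -> open_nbhs (f i) (O i)) -> trivIset S O ->
  exists L : set X,
    [/\ closed L, lindelof (set_type L) & forall i, S i -> L (f i)].
Proof.
move=> hX dB sclX fO tO.
have /choice[Q QP] i : exists Q : set (set X), S i ->
    [/\ cellular Q, forall A, Q A -> A `<=` O i &
     forall L, closed L -> (forall A, Q A -> L `&` A !=set0) -> L (f i)].
  have [Si|nSi] := pselect (S i); last by exists set0.
  by have [Q] := cellular_family_forcing_point hX dB (fO i Si); exists Q.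
have [|L [cL lL hL]] := sclX (\bigcup_(i in S) Q i).
  split.
  - by move=> A [i Si QA]; have [[oQ _ _] _ _] := QP i Si; exact: oQ.
  - by move=> A [i Si QA]; have [[_ nQ _] _ _] := QP i Si; exact: nQ.
  - move=> A A' [i Si QA] [j Sj QA'] [x [Ax A'x]].
    have [[_ _ tQ] QO _] := QP i Si; have [_ QO' _] := QP j Sj.
    have ij : i = j.
      by apply: tO => //; exists x; split; [exact: QO Ax|exact: QO' A'x].
    by rewrite -ij in QA'; apply: tQ => //; exists x.
exists L; split=> // i Si; have [_ _] := QP i Si; apply=> // A QA.
by apply: hL; exists i.
Qed.

(** Closed subsets of a Lindelof subspace are Lindelof, for covers by open sets
    of the ambient space: add the complement of [C] to the cover. *)
Lemma lindelof_subcover (X : topologicalType) (L C : set X) (I : Type)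
    (D : set I) (G : I -> set X) :
  lindelof (set_type L) -> closed C -> C `<=` L ->
  (forall i, D i -> open (G i)) -> C `<=` \bigcup_(i in D) G i ->
  exists T, [/\ T `<=` D, countable T & C `<=` \bigcup_(i in T) G i].
Proof.
move=> lL cC CL oG CG.
pose trace (A : set X) : set (set_type L) := set_val @^-1` A.
have otrace A : open A -> open (trace A) by move=> oA; exists A.
have [||V [VU cV Vcov]] := lL (trace @` [set A | A = ~` C \/ exists2 i, D i & A = G i]).
- move=> _ [A [->|[i Di ->]] <-]; apply: otrace; first exact: closed_openC.
  exact: oG.
- apply/seteqP; split=> // x _.
  have [/CG[i Di Gx]|nCx] := pselect (C (val x)).
    by exists (trace (G i)) => //; exists (G i) => //; right; exists i.
  by exists (trace (~` C)) => //; exists (~` C) => //; left.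
have /choice[h hP] (A : set (set_type L)) : exists o : option I,
    (exists2 i, D i & A = trace (G i)) ->
    exists i, [/\ o = Some i, D i & A = trace (G i)].
  have [[i Di Ai]|nA] := pselect (exists2 i, D i & A = trace (G i)).
    by exists (Some i) => _; exists i.
  by exists None.
exists (D `&` (Some @^-1` (h @` V))); split.
- by move=> i [].
- apply: (sub_countable (subset_card_le (@subIsetr _ _ _))).
  apply: countable_preimage_inj; first by move=> ? ? [].
  exact: countable_image_set.
- move=> x Cx; pose y : set_type L := SigSub (mem_set (CL x Cx)).
  have : cover V id y by rewrite Vcov.
  move=> [A VA Ay]; have [A' [A'E|[i Di A'E]] AE] := VU A VA.
    by move: Ay; rewrite -AE A'E.
  have [|j [hA Dj Aj]] := hP A; first by exists i; rewrite // -AE A'E.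
  by exists j; [split=> //; exists A|move: Ay; rewrite Aj].
Qed.

(** * The covering theorem *)

(** The exclusion of [f a] is required level by level because this is exactly what
    separates points of equal level: [f a] lies outside the closure of the union
    of the earlier neighbourhoods of its own level, so removing that closure from
    [U (f a)] gives a disjoint expansion. *)
Lemma countable_subfamily_levelwise_dense (X : topologicalType)
    (B : X -> nat -> set X) (H : set X) (U : X -> set X) (n : X -> nat) :
  hausdorff_space X -> decreasing_base B -> strongly_cellular_lindelof X ->
  closed H -> (forall x, H x -> open_nbhs x (U x)) ->
  exists Z, [/\ Z `<=` H, countable Z &
    forall x, H x -> exists m,
      closure (\bigcup_(z in [set z | Z z /\ n z = m]) U z) x].
Proof.
move=> hX dB sclX cH HU.
pose V Z m := \bigcup_(z in [set z | Z z /\ n z = m]) U z.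
apply: contrapT => bad.
have {}bad Z : Z `<=` H -> countable Z ->
    exists x, H x /\ forall m, ~ closure (V Z m) x.
  move=> ZH cZ; apply: contrapT => nb; apply: bad; exists Z; split=> // x Hx.
  by apply: contrapT => nm; apply: nb; exists x; split=> // m cl; apply: nm; exists m.
have [W [lt [wf lt_trans lt_tri uncW cseg]]] := exists_omega1.
(* Psi A holds the centres of a countable cover of closure A, if A lies in a
   closed Lindelof set *)
have /choice[Psi PsiP] (A : set X) : exists C, [/\ C `<=` H, countable C &
    forall L, closed L -> lindelof (set_type L) -> A `<=` L -> A `<=` H ->
      closure A `<=` \bigcup_(z in C) U z].
  have [[L [cL lL AL AH]]|nL] := pselect (exists L,
      [/\ closed L, lindelof (set_type L), A `<=` L & A `<=` H]); last first.
    exists set0; split=> // L cL lL AL AH.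
    by exfalso; apply: nL; exists L.
  have clS K : closed K -> A `<=` K -> closure A `<=` K.
    by move=> cK AK; rewrite [X in _ `<=` X](closure_id K).1//; exact: closureS.
  have [||||C [CH cC clC]] := @lindelof_subcover X L (closure A) X H U lL.
  - exact: closed_closure.
  - exact: clS.
  - by move=> z /HU[].
  - by move=> z /(clS _ cH AH) Hz; exists z => //; exact: (HU z Hz).2.
  by exists C.
pose past (f : W -> X) b m := f @` [set c | lt c b /\ n (f c) = m].
(* b = a is allowed, so that the closures of the pasts of a itself are covered
   before f a is chosen *)
pose Zs a f := f @` [set b | lt b a] `|`
  \bigcup_(b in [set b | b = a \/ lt b a]) \bigcup_m Psi (past f b m).
have csegle a : countable [set b | b = a \/ lt b a].
  have -> : [set b | b = a \/ lt b a] = [set a] `|` [set b | lt b a] by [].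
  by rewrite -bigcup2E; apply: bigcup_countable => // -[|[|]] //= _; exact: countable1.
have cZs a f : countable (Zs a f).
  rewrite /Zs -bigcup2E; apply: bigcup_countable => // -[|[|//]] /= _.
    exact/countable_image_set/cseg.
  apply: bigcup_countable => // b _; apply: bigcup_countable => // m _.
  by have [] := PsiP (past f b m).
have [x0 _] := bad set0 (@sub0set _ _) (@countable0 _).
have [f fP] : exists f, forall a,
    H (f a) /\ forall m, ~ closure (V (Zs a f) m) (f a).
  apply: (@wf_recursive_choice W X lt
    (fun a f v => H v /\ forall m, ~ closure (V (Zs a f) m) v) x0 wf).
    move=> a f g v fg; suff -> : Zs a f = Zs a g by [].
    have pastE b m : b = a \/ lt b a -> past f b m = past g b m.
      move=> ba; have e c : lt c b -> f c = g c.
        by case: ba => [->|ba] cb; apply: fg => //; exact: lt_trans ba.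
      apply/seteqP; split=> _ [c [cb cm] <-]; exists c; rewrite ?e//.
        by split=> //; rewrite -e.
      by split=> //; rewrite e.
    congr (_ `|` _).
      by apply/seteqP; split=> _ [c ca <-]; exists c => //; rewrite fg.
    by apply: eq_bigcupr => b ba; apply: eq_bigcupr => m _; rewrite pastE.
  move=> a f fH; apply: bad; last exact: cZs.
  move=> z [[b ba <-]|[b _ [m _]]]; first exact: (fH b ba).1.
  by have [h _ _] := PsiP (past f b m); exact: h.
have ZsH a : Zs a f `<=` H.
  move=> z [[b ba <-]|[b _ [m _]]]; first exact: (fP b).1.
  by have [h _ _] := PsiP (past f b m); exact: h.
have Zsmono a b : lt a b -> Zs a f `<=` Zs b f.
  move=> ab z [[c ca <-]|[c ca hz]].
    by left; exists c => //=; exact: lt_trans ab.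
  by right; exists c => //; right; case: ca => [->//|ca]; exact: lt_trans ab.
have fV a m z : Zs a f z -> n z = m -> ~ U z (f a).
  move=> Zz nz Uz; have [_ /(_ m)] := fP a; apply.
  by apply: subset_closure; exists z.
have [m uncS] : exists m, ~ countable [set a | n (f a) = m].
  apply: contrapT => hc; apply: uncW.
  have -> : [set: W] = \bigcup_m [set a | n (f a) = m].
    by apply/seteqP; split=> // a _; exists (n (f a)).
  apply: bigcup_countable => // m _; apply: contrapT => h; apply: hc.
  by exists m.
pose S := [set a | n (f a) = m]; rewrite -/S in uncS.
(* S is cofinal above countable sets, as it is uncountable and initial segments
   are countable *)
have above (T : set W) : countable T -> exists2 a, S a & forall t, T t -> lt t a.
  move=> cT; apply: contrapT => hn; apply: uncS.
  apply: (@sub_countable _ _ _ (\bigcup_(t in T) [set b | b = t \/ lt b t])); last first.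
    exact: bigcup_countable.
  apply: subset_card_le => a Sa; apply: contrapT => na.
  apply: hn; exists a => // t Tt; have [//|ta|at_] := lt_tri t a.
    by exfalso; apply: na; exists t => //; left.
  by exfalso; apply: na; exists t => //; right.
have [||L [cL lL fL]] := @disjoint_expansion_lindelof X B W S f
    (fun a => U (f a) `&` ~` closure (V (Zs a f) m)) hX dB sclX.
- move=> a Sa; have [Ha /(_ m) nV] := fP a; have [oU Ua] := HU _ Ha.
  split; last by split.
  by apply: openI => //; apply/closed_openC/closed_closure.
- have disj a b : S b -> lt b a ->
      ~ ((U (f a) `&` ~` closure (V (Zs a f) m)) `&` U (f b) !=set0).
    move=> Sb ba [x [[_ nx] Ux]]; apply: nx; apply: subset_closure.
    by exists (f b) => //; split=> //; left; exists b.
  move=> a b Sa Sb [x [[Ua na] [Ub nb]]]; have [ab|//|ba] := lt_tri a b.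
    by exfalso; apply: (disj b a) => //; exists x.
  by exfalso; apply: (disj a b) => //; exists x.
(* the past of level m lies in the closed Lindelof set L, so Psi covers its
   closure *)
have clpast a : closure (past f a m) `<=` \bigcup_(z in Zs a f) U z.
  have [_ _ /(_ L cL lL)] := PsiP (past f a m) => h.
  apply: subset_trans (h _ _) _.
  - by move=> _ [c [_ cm] <-]; exact: fL.
  - by move=> _ [c _ <-]; exact: (fP c).1.
  - move=> x [z Pz Uz]; exists z => //; right; exists a; first by left.
    by exists m.
have clS : closure (f @` S) `<=` L.
  rewrite [X in _ `<=` X](closure_id L).1//; apply: closureS => _ [a Sa <-].
  exact: fL.
have [|||T [_ cT clT]] := @lindelof_subcover X L (closure (f @` S)) W setT
   (fun a => \bigcup_(z in Zs a f) U z) lL _ clS.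
- exact: closed_closure.
- by move=> a _; apply: bigcup_open => z /ZsH/HU[].
- move=> y /(closure_baseP _ _ dB) hy.
  (* y is the limit of points f (t k), and some stage a comes after all t k *)
  have /choice[t tP] k : exists a, S a /\ B y k (f a).
    by have [_ [[a Sa <-] Ba]] := hy k; exists a.
  have [|a Sa ta] := above (range t); first exact: countable_image_set.
  exists a => //; apply: clpast; apply/(closure_baseP _ _ dB) => k.
  exists (f (t k)); have [Sk Bk] := tP k; split=> //; exists (t k) => //.
  by split=> //; apply: ta; exists k.
have [a Sa Ta] := above T cT.
have [|t Tt [z Zz Uz]] := clT (f a); first by apply: subset_closure; exists a.
by apply: (fV a (n z) z) => //; apply: Zsmono Zz; exact: Ta.
Qed.

(** * The cardinality bound *)

Theorem corollary4p4 (X : topologicalType) :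
  first_countable X -> hausdorff_space X -> strongly_cellular_lindelof X ->
  ([set: X] #<= [set: nat -> bool])%card.
Proof.
move=> /exists_decreasing_base[B dB] hX sclX.
have [[x0 _]|nX] := pselect (exists x : X, True); last first.
  suff -> : [set: X] = set0 by exact: card_ge0.
  by apply/seteqP; split=> // x _; apply: nX; exists x.
pose V (c : nat -> nat) (s : nat -> X) m :=
  \bigcup_(i in [set i | c i = m]) B (s i) m.
(* the only possible limit of s, if its k-th term lies in the k-th basic
   neighbourhood of that limit *)
have /choice[lim limP] (s : nat -> X) : exists y, forall z,
    (forall k, B z k (s k)) -> y = z.
  have [[z sz]|nz] := pselect (exists z, forall k, B z k (s k)); last first.
    by exists x0 => z sz; exfalso; apply: nz; exists z.
  exists z => z' sz'; apply: contrapT => zz'.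
  have [k kzz'] := hausdorff_base_separation hX dB zz'.
  by have : (B z k `&` B z' k) (s k) by []; rewrite kzz'.
have /choice[out outP] (cs : (nat -> nat) * (nat -> X)) : exists q,
    (exists p, forall m, ~ closure (V cs.1 cs.2 m) p) ->
    forall m, ~ closure (V cs.1 cs.2 m) q.
  have [[p hp]|np] := pselect (exists p, forall m, ~ closure (V cs.1 cs.2 m) p).
    by exists p.
  by exists x0.
(* None stands for the limit operation, Some c for the choice of an uncovered
   point; the successor keeps the codes of Some c away from that of None *)
pose code (o : option (nat -> nat)) i := if o is Some c then (c i).+1 else 0.
have codeI : injective code.
  move=> [c|] [d|] // /(congr1 (fun h => h _)) e.
  - by congr Some; apply: funext => i; case: (e i).
  - by have := e 0.
  - by have := e 0.
have [H [Hx0 HF cardH]] := closing_off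
  (fun o s => if o is Some c then out (c, s) else lim s) x0 codeI.
suff -> : [set: X] = H by [].
have cH : closed H.
  move=> y /(closure_baseP _ _ dB) hy.
  have /choice[s sP] k : exists x, H x /\ B y k x.
    by have [x [Hx Bx]] := hy k; exists x.
  rewrite -(limP s y); last by move=> k; exact: (sP k).2.
  by apply: (HF None) => k; exact: (sP k).1.
apply/seteqP; split=> // p _; apply: contrapT => nHp.
have /choice[n nP] x : exists n, H x -> B x n `&` B p n = set0.
  have [Hx|nHx] := pselect (H x); last by exists 0.
  have xp : x <> p by move=> xp; apply: nHp; rewrite -xp.
  by have [k hk] := hausdorff_base_separation hX dB xp; exists k.
have [|Z [ZH cZ ZP]] := countable_subfamily_levelwise_dense
    (U := fun x => B x (n x)) n hX dB sclX cH.
  by move=> x _; have [] := dB x.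
have [|s sZ] := countable_range cZ.
  have [m] := ZP x0 Hx0; have [Bo _ _] := dB x0.
  move=> /(_ _ (open_nbhs_nbhs (Bo 0)))[y [[z [Zz _] _] _]].
  by exists z.
have Zs i : Z (s i) by rewrite -sZ; exists i.
have sH i : H (s i) by exact: ZH.
have [m clm] := ZP _ (HF (Some (n \o s)) s sH).
have /(_ _ m) := outP (n \o s, s); apply => /=.
  (* p itself is uncovered: B p k misses every B (s i) k with n (s i) = k *)
  exists p => k /(closure_baseP _ _ dB)/(_ k)[y [[i /= ik Bi] By]].
  have : (B (s i) k `&` B p k) y by [].
  by rewrite -ik nP.
apply: closureS clm => y [z [Zz zm] By].
have : range s z by rewrite sZ.
by move=> [i _ iz]; exists i; rewrite /= ?iz// -zm.
Qed.
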